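(* Let $\varphi\colon\mathcal{X}\to\,]-\infty,+\infty]$ be proper, let $x\in\mathcal{X}$, let $u^*\in\mathcal{X}^*$, and let $\gamma\in\,]0,+\infty[$. Suppose that $z\in R_{\partial(\gamma(\varphi-u^* ))}x$. Then $$L_\varphi(x,u^* )\geq H_{\partial\varphi}(x,u^* )\geq\frac{\|x-z\|^2}{\gamma}\geq\frac{1}{2}d^2_{\operatorname{gra}\partial\varphi,\gamma}(x,u^* ).$$
   Context: $\mathcal{X}\neq\{0\}$ is a reflexive real Banach space with topological dual $\mathcal{X}^*$, and $\langle\cdot,\cdot\rangle$ is the canonical duality pairing. A function $\varphi\colon\mathcal{X}\to\,]-\infty,+\infty]$ is proper if $\operatorname{dom}\varphi=\{x\mid\varphi(x)<+\infty\}\neq\varnothing$; its conjugate is $\varphi^*\colon x^*\mapsto\sup_{x\in\mathcal{X}}(\langle x,x^*\rangle-\varphi(x))$; its Fenchel--Young function is $L_\varphi\colon\mathcal{X}\times\mathcal{X}^*\to\,]-\infty,+\infty]\colon(x,u^* )\mapsto\varphi(x)+\varphi^*(u^* )-\langle x,u^*\rangle$; its subdifferential (no convexity is required) is $\partial\varphi\colon\mathcal{X}\to2^{\mathcal{X}^*}\colon x\mapsto\{x^*\in\mathcal{X}^*\mid(\forall y\in\mathcal{X})\ \langle y-x,x^*\rangle+\varphi(x)\leq\varphi(y)\}$. For $u^*\in\mathcal{X}^*$, $\varphi-u^*$ denotes the function $y\mapsto\varphi(y)-\langle y,u^*\rangle$. For a set-valued operator $A\colon\mathcal{X}\to 2^{\mathcal{X}^*}$,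 $\operatorname{gra}A=\{(x,x^* )\mid x^*\in Ax\}$ and its Haraux function is $H_A\colon(x,u^* )\mapsto\sup_{(y,y^* )\in\operatorname{gra}A}\langle x-y,y^*-u^*\rangle$. The duality mapping of $\mathcal{X}$ is $\Delta\colon x\mapsto\{x^*\in\mathcal{X}^*\mid\|x\|^2=\langle x,x^*\rangle=\|x^*\|^2\}$. The metric resolvent of $A$ is $R_A\colon\mathcal{X}\to2^{\mathcal{X}}\colon x\mapsto\{z\in\mathcal{X}\mid 0\in Az+\Delta(z-x)\}$. For $\gamma\in\,]0,+\infty[$, set $|||(x,x^* )|||_\gamma=\sqrt{\|x\|^2/\gamma+\gamma\|x^*\|^2}$ for $(x,x^* )\in\mathcal{X}\times\mathcal{X}^*$, and for $\boldsymbol{C}\subset\mathcal{X}\times\mathcal{X}^*$ set $d_{\boldsymbol{C},\gamma}(x,x^* )=\inf_{(y,y^* )\in\boldsymbol{C}}|||(x,x^* )-(y,y^* )|||_\gamma\in[0,+\infty]$. *)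

(* Defs.v *)
From HB Require Import structures.
From mathcomp Require Import all_boot all_order all_algebra.
From mathcomp Require Import all_classical all_reals all_analysis.

Set Implicit Arguments.
Unset Strict Implicit.
Unset Printing Implicit Defensive.

Import Order.TTheory GRing.Theory Num.Theory.
Import numFieldNormedType.Exports.

Local Open Scope classical_set_scope.
Local Open Scope ring_scope.

Section Dual.
Context {R : realType} {X : normedModType R}.
Implicit Types f : X -> R.

Definition continuous_linear_pred : {pred (X -> R)} :=
  [pred f | `[< linear f /\ continuous f >]].

Lemma continuous_linear_submod : submod_closed continuous_linear_pred.
Proof.
split.
  apply/asboolP; split=> [a x y|x]; last exact: cvg_cst.
  by rewrite /= scaler0 addr0.
move=> a f g /asboolP[lf cf] /asboolP[lg cg]; apply/asboolP; split.
  move=> b x y; rewrite !fctE lf lg !scalerDr !scalerA (mulrC a b).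
  by rewrite addrACA.
move=> x; apply: cvgD; last exact: cg.
by apply: cvgZr; exact: cf.
Qed.

HB.instance Definition _ :=
  GRing.isSubmodClosed.Build R (X -> R) continuous_linear_pred
    continuous_linear_submod.

End Dual.

Record top_dual (R : realType) (X : normedModType R) := Dual {
  dual_fun :> X -> R;
  _ : dual_fun \in continuous_linear_pred }.

Section DualTheory.
Context {R : realType} {X : normedModType R}.
Local Notation X' := (top_dual X).

HB.instance Definition _ := [isSub for @dual_fun R X].
HB.instance Definition _ := [Choice of X' by <:].
HB.instance Definition _ := [SubChoice_isSubLmodule of X' by <:].

Lemma dual_linear (u : X') : linear u.
Proof. by case: u => f /= /asboolP[]. Qed.

Lemma dual_continuous (u : X') : continuous u.
Proof. by case: u => f /= /asboolP[]. Qed.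

HB.instance Definition _ (u : X') :=
  GRing.isLinear.Build R X R _ (dual_fun u) (@dual_linear u).

Lemma dualP (u v : X') : u =1 v <-> u = v.
Proof. by split=> [uv|-> //]; apply/val_inj/funext. Qed.

Lemma dualDE (u v : X') x : (u + v) x = u x + v x. Proof. by []. Qed.
Lemma dualBE (u v : X') x : (u - v) x = u x - v x. Proof. by []. Qed.
Lemma dualZE a (u : X') x : (a *: u) x = a * u x. Proof. by []. Qed.

Definition dual_norm (u : X') : R :=
  sup [set `|u x| | x in [set x : X | `|x| <= 1]].

Lemma dual_norm_has_sup (u : X') :
  has_sup [set `|u x| | x in [set x : X | `|x| <= 1]].
Proof.
split; first by exists `|u 0|; exists 0 => //=; rewrite normr0.
have /linear_boundedP[M [_ /(_ (M + 1))]] :=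
  @continuous_linear_bounded _ _ _ 0 u (@dual_continuous u 0).
rewrite ltrDl ltr01 => /(_ isT) h; exists `|M + 1| => _ [x /= x1 <-].
apply: le_trans (h x) _; apply: le_trans (_ : `|M + 1| * `|x| <= _).
  by rewrite ler_wpM2r// ler_norm.
by rewrite ler_piMr.
Qed.

Lemma dual_norm_ub (u : X') (x : X) : `|x| <= 1 -> `|u x| <= dual_norm u.
Proof.
move=> x1; apply: (sup_upper_bound (dual_norm_has_sup u)); exists x => //.
Qed.

Lemma dual_norm_le (u : X') (c : R) :
  (forall x : X, `|x| <= 1 -> `|u x| <= c) -> dual_norm u <= c.
Proof.
move=> h; apply: ge_sup; first by case: (dual_norm_has_sup u).
by move=> _ [x /= x1 <-]; exact: h.
Qed.

Lemma dual_norm_ge0 (u : X') : 0 <= dual_norm u.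
Proof. by apply: le_trans (dual_norm_ub u (x := 0) _); rewrite ?normr0. Qed.

Lemma ler_dual_norm (u : X') x : `|u x| <= dual_norm u * `|x|.
Proof.
have [->|x0] := eqVneq x 0; first by rewrite linear0 !normr0 mulr0.
have xp : 0 < `|x| by rewrite normr_gt0.
have := @dual_norm_ub u (`|x|^-1 *: x) _.
rewrite linearZ/= !normrZ normfV normr_id mulVf ?gt_eqF// => /(_ (lexx _)).
by rewrite mulrC ler_pdivrMr.
Qed.

Lemma dual_norm_triangle (u v : X') :
  dual_norm (u + v) <= dual_norm u + dual_norm v.
Proof.
apply: dual_norm_le => x x1; rewrite dualDE (le_trans (ler_normD _ _))//.
by apply: lerD; exact: dual_norm_ub.
Qed.

Lemma dual_normZ_le a (u : X') : dual_norm (a *: u) <= `|a| * dual_norm u.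
Proof.
apply: dual_norm_le => x x1; rewrite dualZE normrM ler_wpM2l//.
exact: dual_norm_ub.
Qed.

Lemma dual_norm0_eq0 (u : X') : dual_norm u = 0 -> u = 0.
Proof.
move=> u0; apply/dualP => x; apply/eqP; rewrite -normr_le0.
by apply: le_trans (ler_dual_norm u x) _; rewrite u0 mul0r.
Qed.

Lemma dual_normZ a (u : X') : dual_norm (a *: u) = `|a| * dual_norm u.
Proof.
apply/eqP; rewrite eq_le dual_normZ_le/=.
have [->|a0] := eqVneq a 0; first by rewrite normr0 mul0r dual_norm_ge0.
rewrite -ler_pdivlMl ?normr_gt0// -normfV.
by apply: le_trans (dual_normZ_le _ _); rewrite scalerA mulVf// scale1r.
Qed.

HB.instance Definition _ := Lmodule_isNormed.Build R X'
  dual_norm_triangle dual_normZ dual_norm0_eq0.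

Lemma ler_dual (u : X') (x : X) : `|u x| <= `|u| * `|x|.
Proof. exact: ler_dual_norm. Qed.

End DualTheory.

Section Bidual.
Context {R : realType} {X : normedModType R}.

Lemma eval_continuous_linear (x : X) :
  (fun u : top_dual X => u x) \in continuous_linear_pred.
Proof.
apply/asboolP; split; first by move=> a u v.
move=> u; apply/(@cvgrPdist_lt R R (top_dual X) (nbhs u)) => e e0.
apply/nbhs_ballP; exists (e / (`|x| + 1)) => /=.
  by rewrite divr_gt0// ltr_wpDl.
rewrite -ball_normE => v; rewrite /ball_/= ltr_pdivlMr ?ltr_wpDl// => uv.
rewrite -dualBE (le_lt_trans (ler_dual _ _))// (le_lt_trans _ uv)//.
by rewrite ler_wpM2l// lerDl.
Qed.

Definition bidual_embedding (x : X) : top_dual (top_dual X) :=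
  Dual (eval_continuous_linear x).

End Bidual.

Definition reflexive_space (R : realType) (X : normedModType R) : Prop :=
  set_surj [set: X] [set: top_dual (top_dual X)] bidual_embedding.

Section ConvexAnalysis.
Context {R : realType} {X : normedModType R}.
Implicit Types (phi : X -> \bar R) (A : X -> set (top_dual X)).

Definition edom phi : set X := [set x | (phi x < +oo)%E].

(* Properness of phi : X -> ]-oo, +oo]; that phi avoids -oo belongs to its
   codomain and is not included here. *)
Definition proper_function phi : Prop := edom phi !=set0.

Definition conjugate phi (u : top_dual X) : \bar R :=
  ereal_sup [set ((u x)%:E - phi x)%E | x in [set: X]].

(* When phi is proper and avoids -oo, conjugate phi u > -oo, so this sum never
   meets the convention +oo + -oo = -oo. *)
Definition fenchel_young phi (x : X) (u : top_dual X) : \bar R :=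
  (phi x + conjugate phi u - (u x)%:E)%E.

Definition subdifferential phi (x : X) : set (top_dual X) :=
  [set u : top_dual X | forall y : X, ((u (y - x))%:E + phi x <= phi y)%E].

Definition gra A : set (X * top_dual X) := [set p | A p.1 p.2].

Definition haraux A (x : X) (u : top_dual X) : \bar R :=
  ereal_sup [set ((p.2 - u) (x - p.1))%:E | p in gra A].

Definition duality_mapping (x : X) : set (top_dual X) :=
  [set u : top_dual X | `|x| ^+ 2 = u x /\ u x = `|u| ^+ 2].

Definition metric_resolvent A (x : X) : set X :=
  [set z | [set a + b | a in A z & b in duality_mapping (z - x)] 0].

Definition weighted_norm (gamma : R) (p : X * top_dual X) : R :=
  Num.sqrt (`|p.1| ^+ 2 / gamma + gamma * `|p.2| ^+ 2).

Definition weighted_dist (C : set (X * top_dual X)) (gamma : R)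
    (p : X * top_dual X) : \bar R :=
  ereal_inf [set (weighted_norm gamma (p - q))%:E | q in C].

End ConvexAnalysis.

(* Main.v *)
Require Import Defs.
From HB Require Import structures.
From mathcomp Require Import all_boot all_order all_algebra.
From mathcomp Require Import all_classical all_reals all_analysis.
From mathcomp Require Import ring lra.

(** Why the bounds hold.  Membership of [z] in the metric resolvent provides a
    subgradient [a] of [gamma (phi - u)] at [z] with [- a] in the duality
    mapping at [z - x].  Undoing the scaling and the linear tilt
    ([subdifferential_scale_tilt]) turns [a] into a point
    [(z, u + a / gamma)] of the graph of the subdifferential of [phi].  At this
    point both the Haraux pairing and the weighted distance are explicit,
    because the duality mapping forces [(- a) (z - x) = |z - x|^2 = |a|^2]:
    the pairing is [|x - z|^2 / gamma] and the squared distance to [(x, u)] is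
    [2 |x - z|^2 / gamma].  The supremum defining the Haraux function therefore
    is at least the former and the squared distance to the graph at most the
    latter.  The remaining comparison, [haraux_le_fenchel_young], adds the
    subgradient inequality at [(y, v)] to the Fenchel-Young inequality for
    [(y, u)]; the values [phi y] cancel. *)

Set Implicit Arguments.
Unset Strict Implicit.
Unset Printing Implicit Defensive.

Import Order.TTheory GRing.Theory Num.Theory.
Import numFieldNormedType.Exports.

Local Open Scope classical_set_scope.
Local Open Scope ring_scope.

Section Subdifferential.
Context {R : realType} {X : normedModType R}.
Implicit Types (phi : X -> \bar R) (x y z : X) (u v a : top_dual X).

(** Tested at any point of the domain, the subgradient inequality bounds
    [phi y] by a finite quantity. *)
Lemma subdifferential_fin_num phi y v :
  (forall y, (-oo < phi y)%E) -> proper_function phi ->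
  subdifferential phi y v -> phi y \is a fin_num.
Proof.
move=> phiNy [y0 phiy0] /(_ y0) sub.
have : ((v (y0 - y))%:E + phi y < +oo)%E by exact: le_lt_trans sub phiy0.
by move: (phiNy y); case: (phi y).
Qed.

(** Divide the subgradient inequality by [gamma] and move the linear term [u]
    to the other side; positivity of [gamma] keeps the value [+oo] in place. *)
Lemma subdifferential_scale_tilt phi u (gamma : R) z a :
  0 < gamma -> (forall y, (-oo < phi y)%E) ->
  subdifferential (fun y => (gamma%:E * (phi y - (u y)%:E))%E) z a ->
  subdifferential phi z (u + gamma^-1 *: a).
Proof.
move=> g0 phiNy sub y; move: (sub y) (phiNy y) (phiNy z).
case: (phi y) => [s||]; case: (phi z) => [r||]//=.
- rewrite -!EFinB -!EFinM -!EFinD !lee_fin => ineq _ _.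
  rewrite -[_ (y - z)]/(u (y - z) + gamma^-1 * a (y - z)).
  rewrite -(ler_pM2l g0) !mulrDr mulrA divff ?gt_eqF// mul1r.
  by rewrite (linearB u)/= mulrBr; lra.
- by rewrite gt0_muley ?lte_fin// -EFinB -EFinM.
- by rewrite leey.
Qed.

(** For [v] a subgradient at [y], the inequalities
    [v (x - y) + phi y <= phi x] and [u y - phi y <= conjugate phi u] add up to
    the bound; [phi y] can be cancelled because it is finite. *)
Lemma haraux_le_fenchel_young phi x u :
  (forall y, (-oo < phi y)%E) -> proper_function phi ->
  (haraux (subdifferential phi) x u <= fenchel_young phi x u)%E.
Proof.
move=> phiNy phi_proper; apply: ge_ereal_sup => _ [[y v] /= sub <-].
have := subdifferential_fin_num phiNy phi_proper sub.
have conj_ge : ((u y)%:E - phi y <= conjugate phi u)%E.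
  by apply: ereal_sup_ubound; exists y.
move: sub => /(_ x); rewrite /fenchel_young; move: conj_ge (phiNy x).
case: (phi y) => [r||]//; case: (conjugate phi u) => [c||]//;
  case: (phi x) => [s||]//=.
all: rewrite ?leey// -!EFinB -!EFinD !lee_fin => conj_ge _ sub _.
by rewrite -[_ (x - y)]/(v (x - y) - u (x - y)) (linearB u)/=; lra.
Qed.

(** Squaring is monotone on the nonnegative extended reals, so any point of
    [C] bounds the squared distance without the square root. *)
Lemma weighted_dist_sqr_le (C : set (X * top_dual X)) (gamma : R) p q :
  0 < gamma -> C q ->
  (weighted_dist C gamma p ^+ 2 <=
   (`|p.1 - q.1| ^+ 2 / gamma + gamma * `|p.2 - q.2| ^+ 2)%:E)%E.
Proof.
move=> g0 Cq.
have d_ge0 : (0 <= weighted_dist C gamma p)%E.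
  by apply: le_ereal_inf_tmp => _ [r _ <-]; rewrite lee_fin sqrtr_ge0.
have d_le : (weighted_dist C gamma p <= (weighted_norm gamma (p - q))%:E)%E.
  by apply: ereal_inf_lbound; exists q.
have -> : `|p.1 - q.1| ^+ 2 / gamma + gamma * `|p.2 - q.2| ^+ 2 =
          weighted_norm gamma (p - q) ^+ 2.
  by rewrite sqr_sqrtr// addr_ge0 ?mulr_ge0 ?invr_ge0 ?sqr_ge0// ltW.
by rewrite EFin_expe !expe2; exact: lee_pmul.
Qed.

End Subdifferential.

Theorem proposition4p2 (R : realType) (X : completeNormedModType R)
  (X_neq0 : exists x : X, x != 0)
  (X_reflexive : reflexive_space X)
  (phi : X -> \bar R)
  (phi_gtNy : forall y : X, (-oo < phi y)%E)
  (phi_proper : proper_function phi)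
  (x : X) (u : top_dual X) (gamma : R) (gamma_gt0 : 0 < gamma)
  (z : X)
  (hz : metric_resolvent
          (subdifferential
             (fun y : X => (gamma%:E * (phi y - (u y)%:E))%E)) x z) :
  [/\ (fenchel_young phi x u >= haraux (subdifferential phi) x u)%E,
      (haraux (subdifferential phi) x u >= (`|x - z| ^+ 2 / gamma)%:E)%E &
      ((`|x - z| ^+ 2 / gamma)%:E >=
        (2^-1)%:E *
          weighted_dist (gra (subdifferential phi)) gamma (x, u) ^+ 2)%E].
Proof.
case: hz => a /= sub [b [norm_zx norm_b]] ab0.
(* Here [b = - a], and [b] lies in the duality mapping at [z - x]. *)
have {norm_zx norm_b ab0} [pair_a norm_a] :
    a (x - z) = `|x - z| ^+ 2 /\ `|a| ^+ 2 = `|x - z| ^+ 2.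
  have -> : a = - b by apply/eqP; rewrite -addr_eq0 ab0.
  by rewrite normrN -norm_b distrC -opprB -norm_zx linearN opprK.
have gra_z : gra (subdifferential phi) (z, u + gamma^-1 *: a).
  exact: subdifferential_scale_tilt.
split; first exact: haraux_le_fenchel_young.
  apply: ereal_sup_ubound; exists (z, u + gamma^-1 *: a) => //=.
  rewrite addrAC subrr add0r -[LHS]/(gamma^-1 * a (x - z))%:E pair_a.
  by rewrite mulrC.
(* The two halves of the squared weighted norm coincide, whence the factor
   [2^-1] in the bound. *)
have d2 := weighted_dist_sqr_le (x, u) gamma_gt0 gra_z.
apply: le_trans (lee_wpmul2l _ d2) _; first by rewrite lee_fin invr_ge0.
rewrite -EFinM lee_fin /= opprD addNKr normrN normrZ exprMn norm_a.
rewrite normfV (gtr0_norm gamma_gt0).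
suff -> : 2^-1 * (`|x - z| ^+ 2 / gamma +
    gamma * (gamma^-1 ^+ 2 * `|x - z| ^+ 2)) = `|x - z| ^+ 2 / gamma by [].
by field; rewrite gt_eqF.
Qed.
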